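(* Let $k$ be a field, and suppose that $\mathcal{C}$ has a generic shift functor $S$ such that $S M(s)$ is finitely presented for every $s \geqslant 0$. Then for any finitely generated $\mathcal{C}$-module $V$, the Hilbert function $H_V:\mathbb{N}\to\mathbb{N}$, $n\mapsto \dim_k V_n$, coincides for $n\gg 0$ with a polynomial with rational coefficients of degree not exceeding $\operatorname{gd}(V)$.
   Context: $\mathbb{N}$ is the set of nonnegative integers. $\mathcal{C}$ denotes a category whose objects are the nonnegative integers, which is $k$-linear (enriched over $k$-modules), locally finite (each $\mathcal{C}(r,s)$ is a finitely generated $k$-module) and directed ($\mathcal{C}(r,s)=0$ whenever $r>s$). A $\mathcal{C}$-module $V$ is a covariant $k$-linear functor from $\mathcal{C}$ to $k$-modules; write $V_s=V(s)$. It is finitely generated if it contains a finite set of elements (of the various $V_s$) contained in no proper submodule. For $s\geqslant 0$, $M(s)=\mathcal{C}(s,-)$ is the representable (projective) $\mathcal{C}$-module. $V$ is generated in degrees $\leqslant s$ if the only submodule of $V$ containing $V_r$ for all $r\leqslant s$ is $V$; $V$ is generated in degrees $\leqslant -1$ if $V=0$. The generating degree $\operatorname{gd}(V)$ is the minimal $s\geqslant -1$ such that $V$ is generated in degrees $\leqslant s$ ($\infty$ if none exists); so $\operatorname{gd}(0)=-1$. The zero polynomial is regarded as having degree $-\infty$. A $\mathcal{C}$-module is finitely presented if it has a projective resolution $\cdots\to P^2\to P^1\to P^0\to V\to 0$ with $P^0$ and $P^1$ finitely generated. A self-embedding functor of degree 1 is a faithful ($k$-linear) functor $\iota:\mathcal{C}\to\mathcal{C}$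 with $\iota(s)=s+1$ for all $s\geqslant 0$. A shift functor is the pull-back functor $S=\iota^*$ on the category of all $\mathcal{C}$-modules, $SV=V\circ\iota$ (so $(SV)_s=V_{s+1}$), for such an $\iota$. A shift functor $S$ is generic if there is a natural transformation $\mu:\mathrm{Id}\to S$ such that for every $s\geqslant 0$ the map $\mu_{M(s)}:M(s)\to SM(s)$ is injective and its cokernel is generated in degrees $\leqslant s-1$. *)

(* Defs.v *)
From HB Require Import structures.
From mathcomp Require Import all_boot all_order all_algebra.
From mathcomp Require Import boolp constructive_ereal.

Set Implicit Arguments.
Unset Strict Implicit.
Unset Printing Implicit Defensive.

Import Order.TTheory GRing.Theory Num.Theory.
Local Open Scope ring_scope.
Local Open Scope quotient_scope.

Section Cokernel.
Variables (k : fieldType) (U W : lmodType k) (f : {linear U -> W}).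

Definition img_pred : {pred W} := fun y => `[< exists x, f x = y >].

Lemma img_zmod_closed : zmod_closed img_pred.
Proof.
split; first by apply/asboolP; exists 0; rewrite linear0.
move=> _ _ /asboolP[x <-] /asboolP[y <-].
by apply/asboolP; exists (x - y); rewrite linearB.
Qed.
HB.instance Definition _ := GRing.isZmodClosed.Build W img_pred img_zmod_closed.

(* The quotient W / im f; its zmodType structure comes from ring_quotient, which
   provides no scaling. *)
Definition coker : Type := Quotient.quot img_pred.
HB.instance Definition _ := GRing.Zmodule.on coker.

Definition coker_pi (x : W) : coker := \pi_(Quotient.quot img_pred) x.

Lemma coker_piD : {morph coker_pi : x y / x + y}.
Proof. by move=> x y; rewrite /coker_pi raddfD. Qed.

Lemma coker_pi_surj (q : coker) : exists x, coker_pi x = q.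
Proof. by exists (repr (q : Quotient.quot img_pred)); rewrite /coker_pi reprK. Qed.

Lemma coker_pi_eq x y : coker_pi x = coker_pi y <-> exists u, f u = x - y.
Proof.
rewrite /coker_pi; split => [/eqP|[u fu]].
  by rewrite -Quotient.idealrBE => /asboolP.
by apply/eqP; rewrite -Quotient.idealrBE; apply/asboolP; exists u.
Qed.

Definition coker_scale (a : k) (q : coker) : coker :=
  coker_pi (a *: repr (q : Quotient.quot img_pred)).

Lemma coker_scaleE a x : coker_scale a (coker_pi x) = coker_pi (a *: x).
Proof.
apply/coker_pi_eq; have /coker_pi_eq[u fu] :
  coker_pi (repr (coker_pi x : Quotient.quot img_pred)) = coker_pi x.
  by rewrite /coker_pi reprK.
by exists (a *: u); rewrite linearZ_LR fu scalerBr.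
Qed.

Lemma coker_scalerA a b v : coker_scale a (coker_scale b v) = coker_scale (a * b) v.
Proof. by have [x <-] := coker_pi_surj v; rewrite !coker_scaleE scalerA. Qed.
Lemma coker_scale1r : left_id 1 coker_scale.
Proof. by move=> v; have [x <-] := coker_pi_surj v; rewrite coker_scaleE scale1r. Qed.
Lemma coker_scalerDr : right_distributive coker_scale +%R.
Proof.
move=> a v w; have [x <-] := coker_pi_surj v; have [y <-] := coker_pi_surj w.
by rewrite -coker_piD !coker_scaleE -coker_piD scalerDr.
Qed.
Lemma coker_scalerDl v : {morph coker_scale^~ v : a b / a + b}.
Proof.
move=> a b; have [x <-] := coker_pi_surj v.
by rewrite !coker_scaleE -coker_piD scalerDl.
Qed.
HB.instance Definition _ := GRing.Zmodule_isLmodule.Build k coker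
  coker_scalerA coker_scale1r coker_scalerDr coker_scalerDl.

Lemma coker_piZ a x : coker_pi (a *: x) = a *: coker_pi x.
Proof. by rewrite -coker_scaleE. Qed.

End Cokernel.

Section LinearCategories.
Variable k : fieldType.

(* k-linear categories whose set of objects is nat; chom r s is C(r, s). *)
Record lincat := LinCat {
  chom : nat -> nat -> lmodType k;
  idm : forall r, chom r r;
  ccomp : forall r s t, chom s t -> chom r s -> chom r t;
  comp_linearl : forall r s t (g : chom r s),
    linear (fun f : chom s t => ccomp f g);
  comp_linearr : forall r s t (f : chom s t),
    linear (fun g : chom r s => ccomp f g);
  comp1m : forall r s (f : chom r s), ccomp (idm s) f = f;
  compm1 : forall r s (f : chom r s), ccomp f (idm r) = f;
  compA : forall q r s t (f : chom s t) (g : chom r s) (h : chom q r),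
    ccomp f (ccomp g h) = ccomp (ccomp f g) h }.

Definition fg_space (U : lmodType k) : Prop :=
  exists n (b : 'I_n -> U), forall u, exists c : 'I_n -> k,
    u = \sum_i c i *: b i.

Definition has_dim (U : lmodType k) (d : nat) : Prop :=
  exists b : 'I_d -> U, forall u, exists! c : 'rV[k]_d,
    u = \sum_i c 0 i *: b i.

Definition locally_finite (C : lincat) : Prop :=
  forall r s, fg_space (chom C r s).

Definition directed (C : lincat) : Prop :=
  forall r s, (s < r)%N -> forall f : chom C r s, f = 0.

Section Modules.
Variable C : lincat.

Record cmod := CMod {
  ob :> nat -> lmodType k;
  act : forall r s, chom C r s -> ob r -> ob s;
  act_linearl : forall r s (v : ob r), linear (fun f : chom C r s => act f v);
  act_linearr : forall r s (f : chom C r s), linear (act f);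
  act1 : forall r (v : ob r), act (idm C r) v = v;
  act_comp : forall r s t (f : chom C s t) (g : chom C r s) (v : ob r),
    act (ccomp f g) v = act f (act g v) }.

Record cmod_hom (V W : cmod) := CModHom {
  cfun :> forall s, {linear V s -> W s};
  cfun_nat : forall r s (f : chom C r s) (v : V r),
    cfun s (act f v) = act f (cfun r v) }.

Record submod (V : cmod) := SubMod {
  smem :> forall s, V s -> Prop;
  smem0 : forall s, smem (0 : V s);
  smemD : forall s (u v : V s), smem u -> smem v -> smem (u + v);
  smemZ : forall s (a : k) (v : V s), smem v -> smem (a *: v);
  smem_act : forall r s (f : chom C r s) (v : V r), smem v -> smem (act f v) }.

Definition full (V : cmod) (X : submod V) : Prop := forall s (v : V s), X s v.

Definition finitely_generated (V : cmod) : Prop :=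
  exists n (d : 'I_n -> nat) (x : forall i, V (d i)),
    forall X : submod V, (forall i, X (d i) (x i)) -> full X.

(* For s = -1 the condition on X is vacuous, so that (taking X to be the zero
   submodule) it says exactly that V = 0. *)
Definition generated_le (V : cmod) (s : int) : Prop :=
  forall X : submod V,
    (forall r : nat, r%:Z <= s -> forall v : V r, X r v) -> full X.

Definition gd (V : cmod) : \bar int :=
  match pselect (exists m : nat, `[< generated_le V (m%:Z - 1) >]) with
  | left h => ((ex_minn h)%:Z - 1)%:E
  | right _ => +oo%E
  end.

Definition inj_hom (V W : cmod) (f : cmod_hom V W) : Prop :=
  forall s, injective (f s).
Definition surj_hom (V W : cmod) (f : cmod_hom V W) : Prop :=
  forall s (w : W s), exists v, f s v = w.
Definition exact_at (U V W : cmod) (f : cmod_hom U V) (g : cmod_hom V W) : Prop :=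
  forall s (v : V s), g s v = 0 <-> exists u, f s u = v.

Definition projective (P : cmod) : Prop :=
  forall (V W : cmod) (g : cmod_hom V W) (f : cmod_hom P W),
    surj_hom g -> exists h : cmod_hom P V, forall s x, g s (h s x) = f s x.

Definition finitely_presented (V : cmod) : Prop :=
  exists (P : nat -> cmod) (d : forall i, cmod_hom (P i.+1) (P i))
         (e : cmod_hom (P 0%N) V),
    [/\ forall i, projective (P i),
        surj_hom e,
        exact_at (d 0%N) e /\ (forall i, exact_at (d i.+1) (d i)),
        finitely_generated (P 0%N)
      & finitely_generated (P 1%N)].

Definition repr_mod (s : nat) : cmod :=
  @CMod (chom C s) (fun r t f g => ccomp f g)
    (fun r t g => comp_linearl g) (fun r t f => comp_linearr f)
    (fun r g => comp1m g) (fun q r t f g h => esym (compA f g h)).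

Section CModCokernel.
Variables (V W : cmod) (f : cmod_hom V W).

Definition cmod_coker_act r s (h : chom C r s) (q : coker (f r)) : coker (f s) :=
  coker_pi (f s) (act h (repr (q : Quotient.quot (img_pred (f r))))).

Lemma cmod_coker_actE r s (h : chom C r s) (w : W r) :
  cmod_coker_act h (coker_pi (f r) w) = coker_pi (f s) (act h w).
Proof.
apply/coker_pi_eq; have /coker_pi_eq[u fu] :
  coker_pi (f r) (repr (coker_pi (f r) w : Quotient.quot (img_pred (f r))))
    = coker_pi (f r) w by rewrite /coker_pi reprK.
exists (act h u); rewrite cfun_nat fu.
set w' := repr _; rewrite [w' - w]addrC -[in LHS]scaleN1r act_linearr scaleN1r.
by rewrite addrC.
Qed.

Lemma cmod_coker_linearl r s (q : coker (f r)) :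
  linear (fun h : chom C r s => cmod_coker_act h q).
Proof.
have [w <-] := coker_pi_surj q; move=> a h h'.
by rewrite !cmod_coker_actE -coker_piZ -coker_piD act_linearl.
Qed.
Lemma cmod_coker_linearr r s (h : chom C r s) : linear (cmod_coker_act h).
Proof.
move=> a q q'; have [w <-] := coker_pi_surj q; have [w' <-] := coker_pi_surj q'.
by rewrite -coker_piZ -coker_piD !cmod_coker_actE act_linearr coker_piD coker_piZ.
Qed.
Lemma cmod_coker_act1 r (q : coker (f r)) : cmod_coker_act (idm C r) q = q.
Proof. by have [w <-] := coker_pi_surj q; rewrite cmod_coker_actE act1. Qed.
Lemma cmod_coker_act_comp r s t (g : chom C s t) (h : chom C r s)
    (q : coker (f r)) :
  cmod_coker_act (ccomp g h) q = cmod_coker_act g (cmod_coker_act h q).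
Proof. by have [w <-] := coker_pi_surj q; rewrite !cmod_coker_actE act_comp. Qed.

Definition cmod_coker : cmod :=
  @CMod (fun s => coker (f s)) cmod_coker_act cmod_coker_linearl
    cmod_coker_linearr cmod_coker_act1 cmod_coker_act_comp.
End CModCokernel.

(* Faithful k-linear endofunctors of C given on objects by s |-> s + 1. *)
Record self_embedding := SelfEmbedding {
  emb :> forall r s, chom C r s -> chom C r.+1 s.+1;
  emb_linear : forall r s, linear (@emb r s);
  emb1 : forall r, emb (idm C r) = idm C r.+1;
  emb_comp : forall r s t (f : chom C s t) (g : chom C r s),
    emb (ccomp f g) = ccomp (emb f) (emb g);
  emb_inj : forall r s, injective (@emb r s) }.

Section Shift.
Variable iota : self_embedding.

Lemma shift_linearl (V : cmod) r s (v : V r.+1) :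
  linear (fun f : chom C r s => act (iota r s f) v).
Proof. by move=> a f g; rewrite emb_linear act_linearl. Qed.
Lemma shift_act1 (V : cmod) r (v : V r.+1) : act (iota r r (idm C r)) v = v.
Proof. by rewrite emb1 act1. Qed.
Lemma shift_act_comp (V : cmod) r s t (f : chom C s t) (g : chom C r s)
    (v : V r.+1) :
  act (iota r t (ccomp f g)) v = act (iota s t f) (act (iota r s g) v).
Proof. by rewrite emb_comp act_comp. Qed.

Definition shift (V : cmod) : cmod :=
  @CMod (fun s => V s.+1) (fun r s f => act (iota r s f))
    (@shift_linearl V) (fun r s f => act_linearr (iota r s f))
    (@shift_act1 V) (@shift_act_comp V).

Definition shift_hom (V W : cmod) (f : cmod_hom V W) :
    cmod_hom (shift V) (shift W) :=
  @CModHom (shift V) (shift W) (fun s => f s.+1)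
    (fun r s h v => cfun_nat f (iota r s h) v).

Definition generic_shift : Prop :=
  exists mu : forall V : cmod, cmod_hom V (shift V),
    (forall (V W : cmod) (f : cmod_hom V W) s (v : V s),
        mu W s (f s v) = shift_hom f s (mu V s v)) /\
    (forall s : nat, inj_hom (mu (repr_mod s)) /\
        generated_le (cmod_coker (mu (repr_mod s))) (s%:Z - 1)).
End Shift.

(* H is the Hilbert function of V, all V n being finite-dimensional. *)
Definition is_hilbert_function (V : cmod) (H : nat -> nat) : Prop :=
  forall n, has_dim (V n) (H n).

End Modules.
End LinearCategories.

Definition poly_degree (R : nzRingType) (p : {poly R}) : \bar int :=
  if p == 0 then -oo%E else ((size p).-1%:Z)%:E.

(* Main.v *)
From HB Require Import structures.
Require Import Defs.
From mathcomp Require Import all_boot all_order all_algebra.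
From mathcomp Require Import boolp constructive_ereal.
From mathcomp Require Import ring zify.

Set Implicit Arguments.
Unset Strict Implicit.
Unset Printing Implicit Defensive.

Import Order.TTheory GRing.Theory Num.Theory.
Local Open Scope ring_scope.

(** The natural map mu_V : V -> SV is treated as a shift operator x raising the
    degree by one; by Yoneda it is the action of one element of C(n, n+1) in
    each degree n.  For a submodule U of V put
      - x^-1 U = the v in V with x v in U (mu_preim), which contains U;
      - SU + xV, a submodule of SV (mu_join).
    Multiplication by x identifies V / x^-1 U with the kernel of
    S(V/U) -> SV / (SU + xV), so that
      codim U_(n+1) = codim (x^-1 U)_n + codim (SU + xV)_n.
    If V/U is generated in degrees < s+1, then SV / (SU + xV), which is the
    cokernel of V/U -> S(V/U), is generated in degrees < s: this is where the
    genericity of S enters, through the representable modules mapping to V.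
    Everything is therefore proved by induction on the bound s on the
    generating degree.

    Noetherianity (noetherian_above_generated).  Let U_i be an ascending chain
    of submodules above U.  By induction the chain S(x^-i U_i) + xV stabilizes,
    and this forces x^-i U_i to stabilize, degree by degree: modulo a fixed
    member of the chain, an element of positive degree is a multiple x v with
    v in a later member.  Hence x^-j U_i is eventually constant in i for one
    value of j; as the chains S(x^-j U_i) + xV also stabilize, a descending
    induction on j brings this down to j = 0.

    Growth (hilbert_function_generated).  By Noetherianity the chain x^-j U is
    constant from some j0 on.  Suppose that V/U is generated in degrees < s+1.
    For j = j0 the codimension formula says that the first difference of the
    Hilbert function of V / x^-j U is, by induction, eventually a polynomial of
    degree < s, so the function itself is eventually a polynomial of degree
    <= s; the formula then passes this from j+1 down to j.  The theorem is the
    case U = 0.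

    The quotients V/U are not constructed: V/U enters through the submodules
    lying above U and through the codimensions of the U_n, where a dimension is
    witnessed by a family of vectors that is a basis modulo U_n (reldim). *)

(** * Bases modulo a subspace *)

Section RelativeDimension.
Variable k : fieldType.

Definition subspace (V : lmodType k) (P : V -> Prop) : Prop :=
  P 0 /\ forall a u v, P u -> P v -> P (a *: u + v).

Lemma subspaceB (V : lmodType k) (P : V -> Prop) u v :
  subspace P -> P u -> P v -> P (u - v).
Proof. by move=> [_ PZ] Pu Pv; rewrite addrC -scaleN1r; apply: PZ. Qed.

Definition lincomb (V : lmodType k) n (b : 'I_n -> V) (c : 'rV[k]_n) : V :=
  \sum_i c 0 i *: b i.

Lemma lincomb_is_linear (V : lmodType k) n (b : 'I_n -> V) : linear (lincomb b).
Proof.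
move=> a c c'; rewrite /lincomb scaler_sumr -big_split /=.
by apply: eq_bigr => i _; rewrite !mxE scalerDl scalerA.
Qed.
HB.instance Definition _ (V : lmodType k) n (b : 'I_n -> V) :=
  GRing.isLinear.Build k 'rV[k]_n V _ (lincomb b) (lincomb_is_linear b).

Lemma fg_space_lincomb (V : lmodType k) : fg_space V ->
  exists n (x : 'I_n -> V), forall v, exists c, v = lincomb x c.
Proof.
move=> [n [x spn]]; exists n, x => v; have [c ->] := spn v.
by exists (\row_j c j); apply: eq_bigr => i _; rewrite mxE.
Qed.

(** The quotient of V by the subspace P has dimension d, witnessed by lifts of
    a basis. *)
Definition reldim (V : lmodType k) (P : V -> Prop) (d : nat) : Prop :=
  exists b : 'I_d -> V, (forall v, exists c, P (v - lincomb b c)) /\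
    (forall c, P (lincomb b c) -> c = 0).

Lemma reldim_iff (V : lmodType k) (P Q : V -> Prop) d :
  (forall v, P v <-> Q v) -> reldim P d -> reldim Q d.
Proof.
move=> PQ [b [spn free]]; exists b; split=> [v|c /PQ /free //].
by have [c /PQ] := spn v; exists c.
Qed.

Lemma reldim_full (V : lmodType k) (P : V -> Prop) :
  (forall v, P v) -> reldim P 0.
Proof.
move=> Pfull; exists (fun _ => 0); split=> [v|c _]; first by exists 0.
exact: thinmx0.
Qed.

Lemma has_dim_reldim0 (V : lmodType k) d :
  reldim (fun v : V => v = 0) d -> has_dim V d.
Proof.
move=> [b [spn free]]; exists b => u; have [c /subr0_eq uE] := spn u.
exists c; split=> // c'; rewrite -/(lincomb b c') uE => ccE.
by apply/subr0_eq/free; rewrite linearB /= ccE subrr.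
Qed.

(** Additivity of dimension along 0 -> V / f^-1 P -> W / P -> W / (P + f V) -> 0:
    the images under f of a basis modulo f^-1 P and a basis modulo P + f V form
    together a basis modulo P. *)
Lemma reldim_extension (V W : lmodType k) (f : {linear V -> W}) (P : W -> Prop)
    d1 d2 :
  subspace P -> reldim (fun v => P (f v)) d1 ->
  reldim (fun w => exists u v, P u /\ w = u + f v) d2 -> reldim P (d1 + d2).
Proof.
move=> Psub [b1 [spn1 free1]] [b2 [spn2 free2]].
pose b i := match split i with inl j => f (b1 j) | inr j => b2 j end.
have bE c1 c2 : lincomb b (row_mx c1 c2) = f (lincomb b1 c1) + lincomb b2 c2.
  rewrite /lincomb big_split_ord linear_sum /=; congr (_ + _).
    apply: eq_bigr => i _; rewrite row_mxEl /b.
    by rewrite (unsplitK (inl i)) linearZ.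
  by apply: eq_bigr => i _; rewrite row_mxEr /b (unsplitK (inr i)).
exists b; split=> [w|c].
  have [c2 [u [v [Pu uvE]]]] := spn2 w; have [c1 Pc1] := spn1 v.
  exists (row_mx c1 c2); rewrite bE [f _ + _]addrC opprD addrA uvE -addrA -linearB.
  by rewrite -[u]scale1r; apply: Psub.2.
rewrite -[c]hsubmxK bE; set c1 := lsubmx c; set c2 := rsubmx c => Pc.
have c20 : c2 = 0.
  apply: free2; exists (f (lincomb b1 c1) + lincomb b2 c2), (- lincomb b1 c1).
  by rewrite linearN /= addrAC subrr add0r.
move: Pc; rewrite c20 linear0 addr0 => /free1 ->; exact: row_mx0.
Qed.

(** A matrix of maximal rank among those with rows in P spans P, because adding
    one more vector of P cannot increase the rank. *)
Lemma subspace_rowP n (P : 'rV[k]_n -> Prop) : subspace P ->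
  exists A : 'M[k]_n, forall v, P v <-> (v <= A)%MS.
Proof.
move=> [P0 PZ].
have PD u v : P u -> P v -> P (u + v).
  by move=> Pu Pv; rewrite -[u]scale1r; apply: PZ.
pose inP (A : 'M[k]_n) := forall v : 'rV_n, (v <= A)%MS -> P v.
pose ranked r := `[< exists2 A, inP A & \rank A = r >].
have ex0 : exists r, ranked r.
  exists 0%N; apply/asboolP; exists 0; last exact: mxrank0.
  by move=> v /submx0null ->.
have ub r : ranked r -> (r <= n)%N.
  by move=> /asboolP[A _ <-]; apply: rank_leq_row.
case: (ex_maxnP ex0 ub) => r /asboolP[A AP <-] Amax.
exists A => v; split=> [Pv|]; last exact: AP.
have AvP : inP (A + v)%MS.
  move=> w /sub_addsmxP[[a b] /= ->]; apply: PD; first exact/AP/submxMl.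
  rewrite [b]mx11_scalar mul_scalar_mx -[X in P X]addr0; exact: PZ.
have /Amax rk_le : ranked (\rank (A + v)%MS) by apply/asboolP; exists (A + v)%MS.
apply: submx_trans (addsmxSr A v) _.
by rewrite -(mxrank_leqif_sup (addsmxSl A v)) eqn_leq rk_le mxrankS ?addsmxSl.
Qed.

(** Pulled back along a surjection from k^n the subspace becomes the row space of
    a matrix, and the rows of a complement give a basis modulo it. *)
Lemma reldim_exists (V : lmodType k) (P : V -> Prop) :
  fg_space V -> subspace P -> exists d, reldim P d.
Proof.
move=> /fg_space_lincomb[n [x spn]] [P0 PZ].
have [|A AP] := @subspace_rowP n (fun c => P (lincomb x c)).
  by split=> [|a c c'] /=; rewrite ?linear0 ?linearP //; apply: PZ.
pose B := row_base A^C%MS.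
have lincombB c : lincomb (fun i => lincomb x (row i B)) c = lincomb x (c *m B).
  rewrite mulmx_sum_row linear_sum; apply: eq_bigr => i _; exact/esym/linearZ.
exists (\rank A^C%MS), (fun i => lincomb x (row i B)); split=> [v|c].
  have [c vE] := spn v.
  have : (c <= A + A^C)%MS by rewrite submx_full // addsmx_compl_full.
  case/sub_addsmxP=> [[a a'] /= cE].
  have /submxP[e eE] : (a' *m A^C%MS <= B)%MS by rewrite eq_row_base submxMl.
  exists e; rewrite lincombB vE cE -eE linearD /=.
  by rewrite addrK; apply/AP/submxMl.
rewrite lincombB => /AP cA; apply: (row_free_inj (row_base_free A^C%MS)).
rewrite mul0mx; apply: (@submx0null _ _ n); rewrite -(capmx_compl A) sub_capmx cA /=.
by rewrite (submx_trans (submxMl _ _)) // eq_row_base.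
Qed.

(** Ascending chains of subspaces of a finite-dimensional space are stationary
    from an index of maximal rank on. *)
Lemma subspace_acc (V : lmodType k) (P : nat -> V -> Prop) :
  fg_space V -> (forall i, subspace (P i)) -> (forall i v, P i v -> P i.+1 v) ->
  exists i0, forall i v, P i v -> P i0 v.
Proof.
move=> /fg_space_lincomb[n [x spn]] Psub Pmono.
have PleP i j v : (i <= j)%N -> P i v -> P j v.
  by move=> /subnKC <-; elim: (j - i)%N => [|m IH]; rewrite ?addn0 ?addnS //;
     move/IH/Pmono.
have /choice[A AP] : forall i, exists A : 'M[k]_n,
    forall c, P i (lincomb x c) <-> (c <= A)%MS.
  move=> i; apply: subspace_rowP.
  have [P0 PZ] := Psub i.
  by split=> [|a c c'] /=; rewrite ?linear0 ?linearP //; apply: PZ.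
pose ranked r := `[< exists i, \rank (A i) = r >].
have ex0 : exists r, ranked r by exists (\rank (A 0%N)); apply/asboolP; exists 0%N.
have ub r : ranked r -> (r <= n)%N.
  by move=> /asboolP[i <-]; apply: rank_leq_row.
case: (ex_maxnP ex0 ub) => r /asboolP[i0 <-] Amax; exists i0.
suff Pi0 i : (i0 <= i)%N -> forall v, P i v -> P i0 v.
  move=> i v Piv; apply: (Pi0 (maxn i i0)); first exact: leq_maxr.
  exact: PleP (leq_maxl _ _) Piv.
move=> le_i0i v; have [c ->] := spn v.
move=> /AP cA; apply/AP; apply: submx_trans cA _.
have leA : (A i0 <= A i)%MS.
  by apply/rV_subP => w /AP Pw; apply/AP; apply: PleP Pw.
rewrite -(mxrank_leqif_sup leA) eqn_leq mxrankS //=.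
by apply: Amax; apply/asboolP; exists i.
Qed.

Lemma fg_space_sum (I : finType) (U : I -> lmodType k) (V : lmodType k)
    (f : forall i, {linear U i -> V}) :
  (forall i, fg_space (U i)) ->
  (forall v, exists u : forall i, U i, v = \sum_i f i (u i)) -> fg_space V.
Proof.
move=> U_fg sumV.
have [n nP] := all_tag (fun i => cid (U_fg i)).
have [b spn] := all_tag (fun i => cid (nP i)).
pose T := {i : I & 'I_(n i)}.
pose e (p : T) := f (tag p) (b (tag p) (tagged p)).
exists #|{: T}|, (e \o enum_val) => v.
have [u ->] := sumV v.
have [c cE] := all_tag (fun i => cid (spn i (u i))).
exists (fun j => let p : T := enum_val j in c (tag p) (tagged p)).
rewrite -(big_enum_val (fun p : T => c (tag p) (tagged p) *: e p)) /=.
under eq_bigr => i _ do rewrite cE linear_sum.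
rewrite sig_big_dep /=; apply: eq_bigr => p _; exact: linearZ.
Qed.

End RelativeDimension.

(** * Eventually polynomial functions *)

Section EventuallyPolynomial.

(** The bound s on the size stands for degree < s, so that s = 0 forces the zero
    polynomial. *)
Definition eventually_poly (H : nat -> nat) (s : nat) : Prop :=
  exists p : {poly rat}, (size p <= s)%N /\
    exists N : nat, forall n, (N <= n)%N -> (H n)%:R = p.[n%:R].

(** The leading term c X^s of q is cancelled by the difference of
    (c / (s+1)) X^(s+1), which is c X^s plus terms of lower degree. *)
Lemma antidifference (F : numFieldType) s (q : {poly F}) : (size q <= s)%N ->
  exists p : {poly F}, (size p <= s.+1)%N /\
    forall x, p.[x + 1] = p.[x] + q.[x].
Proof.
elim: s q => [|s IH] q size_q.
  exists 0; split=> [|x]; first by rewrite size_poly0.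
  by move: size_q; rewrite leqn0 size_poly_eq0 => /eqP->; rewrite !horner0 addr0.
pose D : {poly F} := \poly_(i < s.+1) 'C(s.+1, i)%:R.
have DE x : (x + 1) ^+ s.+1 = x ^+ s.+1 + D.[x].
  rewrite addrC exprDn big_ord_recr /= subnn mul1r binn mulr1n addrC.
  rewrite horner_poly; congr (_ + _); apply: eq_bigr => i _.
  by rewrite expr1n mul1r mulr_natl.
pose a := q`_s / s.+1%:R.
have [|p [size_p pE]] := IH (q - a *: D).
  apply/leq_sizeP => j; rewrite leq_eqVlt coefB coefZ coef_poly => /orP[/eqP<-|lt_sj].
    by rewrite ltnSn binSn divfK ?subrr // pnatr_eq0.
  by rewrite ltnNge lt_sj mulr0 subr0 nth_default // (leq_trans size_q).
exists (p + a *: 'X^(s.+1)); split=> [|x].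
  rewrite (leq_trans (size_polyD _ _)) // geq_max (leq_trans size_p) //=.
  by rewrite (leq_trans (size_scale_leq _ _)) // size_polyXn.
rewrite !(hornerD, hornerN, hornerZ, hornerXn) pE DE.
by rewrite !(hornerD, hornerN, hornerZ); ring.
Qed.

Lemma eventually_poly_pred H Hp s : eventually_poly Hp s ->
  (forall n, H n.+1 = Hp n) -> eventually_poly H s.
Proof.
move=> [p [size_p [N pE]]] HE; exists (p \Po ('X - 1%:P)); split.
  rewrite size_comp_poly2 // -[X in X - _]expr1.
  by rewrite size_XsubC.
exists N.+1 => -[//|n] leNn; rewrite HE pE // horner_comp !hornerE.
by rewrite -natr1 addrK.
Qed.

Lemma eventually_polyD H H' s s' : (s' <= s)%N ->
  eventually_poly H s -> eventually_poly H' s' ->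
  eventually_poly (fun n => H n + H' n)%N s.
Proof.
move=> le_s [p [size_p [N pE]]] [p' [size_p' [N' pE']]].
exists (p + p'); split.
  by rewrite (leq_trans (size_polyD _ _)) // geq_max size_p (leq_trans size_p').
exists (maxn N N') => n; rewrite geq_max => /andP[leN leN'].
by rewrite natrD pE // pE' // hornerD.
Qed.

(** Subtracting from H an antidifference of H' leaves a function that is
    eventually constant. *)
Lemma eventually_poly_difference H H' s : eventually_poly H' s ->
  (forall n, H n.+1 = (H n + H' n)%N) -> eventually_poly H s.+1.
Proof.
move=> [q [/antidifference[p [size_p pE]] [N qE]]] HE.
exists (p + ((H N)%:R - p.[N%:R])%:P); split.
  rewrite (leq_trans (size_polyD _ _)) // geq_max size_p /=.
  by rewrite (leq_trans (size_polyC_leq1 _)).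
exists N => n /subnKC<-; rewrite hornerD hornerC.
elim: (n - N)%N => [|m IH]; first by rewrite addn0 subrKC.
by rewrite addnS HE natrD IH qE ?leq_addr // -natr1 pE; ring.
Qed.

End EventuallyPolynomial.

(** * Submodules and relative generation *)

Section Submodules.
Variables (k : fieldType) (C : lincat k).
Implicit Types V : cmod C.

Lemma submod_subspace V (X : submod V) s : subspace (X s).
Proof.
split=> [|a u v Xu Xv]; first exact: smem0.
by apply: smemD Xv; apply: smemZ.
Qed.

Definition sub_le V (X Y : submod V) : Prop := forall s v, X s v -> Y s v.

(** V/U is generated in degrees < s; every submodule of V/U is X/U for some X
    above U. *)
Definition generated_lt V (U : submod V) (s : nat) : Prop :=
  forall X : submod V, (forall r, (r < s)%N -> forall v : V r, X r v) ->
    sub_le U X -> full X.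

Lemma generated_ltS V (U W : submod V) s :
  sub_le U W -> generated_lt U s -> generated_lt W s.
Proof. by move=> UW gen X Xs WX; apply: gen => // t v /UW/WX. Qed.

(** The ascending chain condition for submodules of V/U. *)
Definition noetherian_above V (U : submod V) : Prop :=
  forall Y : nat -> submod V,
    (forall i, sub_le U (Y i)) -> (forall i, sub_le (Y i) (Y i.+1)) ->
    exists i0, forall i, sub_le (Y i) (Y i0).

Lemma chain_le V (Y : nat -> submod V) i j :
  (forall i, sub_le (Y i) (Y i.+1)) -> (i <= j)%N -> sub_le (Y i) (Y j).
Proof.
move=> Ymono /subnKC<-; elim: (j - i)%N => [|m IH] s v; rewrite ?addn0 ?addnS //.
by move/IH/Ymono.
Qed.

Lemma actD V r s (f : chom C r s) (u v : V r) : act f (u + v) = act f u + act f v.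
Proof. by have := act_linearr f 1 u v; rewrite !scale1r. Qed.

Lemma act0 V r s (f : chom C r s) : act f (0 : V r) = 0.
Proof. by apply: (addrI (act f 0)); rewrite -actD !addr0. Qed.

Lemma actZ V r s (f : chom C r s) a (v : V r) : act f (a *: v) = a *: act f v.
Proof. by have := act_linearr f a v 0; rewrite act0 !addr0. Qed.

Lemma actDl V r s (f g : chom C r s) (v : V r) :
  act (f + g) v = act f v + act g v.
Proof. by have := act_linearl v 1 f g; rewrite !scale1r. Qed.

Lemma act0l V r s (v : V r) : act (0 : chom C r s) v = 0.
Proof. by apply: (addrI (act 0 v)); rewrite -actDl !addr0. Qed.

Lemma actZl V r s a (f : chom C r s) (v : V r) : act (a *: f) v = a *: act f v.
Proof. by have := act_linearl v a f 0; rewrite act0l !addr0. Qed.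

(** * The operator given by a natural transformation to the shift *)

Section GenericShift.
Variable iota : self_embedding C.
Local Notation S := (shift iota).
Variable mu : forall V : cmod C, cmod_hom V (S V).
Hypothesis mu_nat : forall (V W : cmod C) (f : cmod_hom V W) s (v : V s),
  mu W s (f s v) = shift_hom iota f s (mu V s v).
Hypothesis mu_gen : forall s,
  generated_le (cmod_coker (mu (repr_mod C s))) (s%:Z - 1).

(** Naturality of mu at the map M(r) -> V, f |-> f v, that corresponds to v. *)
Lemma mu_act V r t (f : chom C r t) (v : V r) :
  mu V t (act f v) = act (mu (repr_mod C r) t f : chom C r t.+1) v.
Proof.
pose lin t := GRing.isLinear.Build k (chom C r t) (V t) _ _ (act_linearl (s := t) v).
pose L t : {linear chom C r t -> V t} :=
  HB.pack (fun g : chom C r t => act g v) (lin t).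
pose F : cmod_hom (repr_mod C r) V :=
  @CModHom _ _ (repr_mod C r) V L (fun a b g h => act_comp g h v).
exact: (mu_nat F).
Qed.

Lemma muE V s (v : V s) :
  mu V s v = act (mu (repr_mod C s) s (idm C s) : chom C s s.+1) v.
Proof. by rewrite -mu_act act1. Qed.

Section Constructions.
Variables (V : cmod C) (U : submod V).

Definition mu_preim_mem s (v : V s) : Prop := U s.+1 (mu V s v).

Lemma mu_preim0 s : mu_preim_mem (0 : V s).
Proof. by rewrite /mu_preim_mem linear0; apply: (@smem0 _ _ V). Qed.
Lemma mu_preimD s (u v : V s) :
  mu_preim_mem u -> mu_preim_mem v -> mu_preim_mem (u + v).
Proof. by rewrite /mu_preim_mem linearD; apply: (@smemD _ _ V). Qed.
Lemma mu_preimZ s a (v : V s) : mu_preim_mem v -> mu_preim_mem (a *: v).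
Proof. by rewrite /mu_preim_mem linearZ; apply: (@smemZ _ _ V). Qed.
Lemma mu_preim_act r s (f : chom C r s) (v : V r) :
  mu_preim_mem v -> mu_preim_mem (act f v).
Proof. by rewrite /mu_preim_mem cfun_nat; apply: (@smem_act _ _ V). Qed.

Definition mu_preim : submod V :=
  @SubMod _ _ V mu_preim_mem mu_preim0 mu_preimD mu_preimZ mu_preim_act.

Definition mu_join_mem s (w : S V s) : Prop :=
  exists u v, U s.+1 u /\ w = u + mu V s v.

Lemma mu_join0 s : mu_join_mem (0 : S V s).
Proof. by exists 0, 0; rewrite linear0 addr0; split=> //; apply: smem0. Qed.
Lemma mu_joinD s (w w' : S V s) :
  mu_join_mem w -> mu_join_mem w' -> mu_join_mem (w + w').
Proof.
move=> [u [v [Uu ->]]] [u' [v' [Uu' ->]]]; exists (u + u'), (v + v').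
by rewrite linearD addrACA; split=> //; apply: smemD.
Qed.
Lemma mu_joinZ s a (w : S V s) : mu_join_mem w -> mu_join_mem (a *: w).
Proof.
move=> [u [v [Uu ->]]]; exists (a *: u), (a *: v).
by rewrite linearZ scalerDr; split=> //; apply: smemZ.
Qed.
Lemma mu_join_act r s (f : chom C r s) (w : S V r) :
  mu_join_mem w -> mu_join_mem (act f w).
Proof.
move=> [u [v [Uu ->]]]; exists (act (iota r s f) u), (act f v).
by rewrite actD cfun_nat; split=> //; apply: smem_act.
Qed.

Definition mu_join : submod (S V) :=
  SubMod mu_join0 mu_joinD mu_joinZ mu_join_act.

End Constructions.

Lemma le_mu_preim V (U : submod V) : sub_le U (mu_preim U).
Proof. by move=> s v Uv; rewrite /= /mu_preim_mem muE; apply: smem_act. Qed.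

Lemma mu_preimS V (U W : submod V) :
  sub_le U W -> sub_le (mu_preim U) (mu_preim W).
Proof. by move=> UW s v /UW. Qed.

Lemma mu_joinS V (U W : submod V) : sub_le U W -> sub_le (mu_join U) (mu_join W).
Proof. by move=> UW s w [u [v [/UW Wu wE]]]; exists u, v. Qed.

(** Let X be a submodule of SV above SU + xV that contains SV in degrees < s,
    that is, all elements of V of degrees 1, ..., s.  The v in V whose images in
    positive degree all lie in X form a submodule Y of V, and it suffices to
    show that Y contains V in degrees r <= s.  For w of degree r, genericity
    writes f in C(r, t+1) modulo the image of mu as a combination of elements
    iota(g) h with h of degree < r in SM(r).  Then h w has degree < s in SV,
    hence lies in X, while the image of mu contributes elements of xV. *)
Lemma generated_lt_mu_join V (U : submod V) s :
  generated_lt U s.+1 -> generated_lt (mu_join U) s.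
Proof.
move=> gen X Xs UX.
have X_mu t (v : V t) : X t (mu V t v).
  by apply: UX; exists 0, v; rewrite add0r; split=> //; apply: smem0.
pose Ymem n (v : V n) := forall t (f : chom C n t.+1), X t (act f v).
have Y0 n : Ymem n 0 by move=> t f; rewrite act0; apply: (smem0 X).
have YD n (u v : V n) : Ymem n u -> Ymem n v -> Ymem n (u + v).
  by move=> Yu Yv t f; rewrite actD; apply: (smemD (Yu t f) (Yv t f)).
have YZ n a (v : V n) : Ymem n v -> Ymem n (a *: v).
  by move=> Yv t f; rewrite actZ; apply: (smemZ a (Yv t f)).
have Yact r n (f : chom C r n) (v : V r) : Ymem r v -> Ymem n (act f v).
  by move=> Yv t g; rewrite -act_comp.
pose Y := SubMod Y0 YD YZ Yact.
suff Yfull : full Y by move=> t v; have := Yfull t.+1 v t (idm C _); rewrite act1.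
apply: gen => [r lt_rs w|n u Uu t f]; last first.
  by apply: UX; exists (act f u), 0; rewrite linear0 addr0; split=> //; apply: smem_act.
(* Genericity speaks of submodules of the cokernel of M(r) -> SM(r); a single
   representative f suffices below because X contains xV. *)
pose D := cmod_coker (mu (repr_mod C r)).
pose Zmem t (q : D t) := exists f : chom C r t.+1,
  coker_pi (mu (repr_mod C r) t) f = q /\ X t (act f w).
have Z0 t : Zmem t 0.
  exists 0; rewrite act0l -[X in coker_pi _ X](scale0r 0) coker_piZ scale0r.
  by split=> //; apply: (smem0 X).
have ZD t (q q' : D t) : Zmem t q -> Zmem t q' -> Zmem t (q + q').
  move=> [f [<- Xf]] [f' [<- Xf']]; exists (f + f'); rewrite coker_piD actDl.
  by split=> //; apply: (smemD Xf).
have ZZ t a (q : D t) : Zmem t q -> Zmem t (a *: q).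
  move=> [f [<- Xf]]; exists (a *: f); rewrite coker_piZ actZl.
  by split=> //; apply: (smemZ a Xf).
have Zact t t' (h : chom C t t') (q : D t) : Zmem t q -> Zmem t' (act h q).
  move=> [f [<- Xf]]; exists (ccomp (iota t t' h) f); rewrite act_comp.
  by split; [rewrite /= cmod_coker_actE | apply: (smem_act h Xf)].
pose Z := SubMod Z0 ZD ZZ Zact.
have Zfull : full Z.
  apply: mu_gen => t le_tr q; have [f fq] := coker_pi_surj q; exists f; split=> //.
  have lt_ts : (t < s)%N by lia.
  exact: (Xs t lt_ts (act f w : S V t)).
move=> t f; have [f' [/esym/coker_pi_eq[g gE] Xf']] :=
  Zfull t (coker_pi (mu (repr_mod C r) t) f).
have -> : act f w = act f' w + mu V t (act g w).
  by rewrite mu_act gE -actDl addrC subrK.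
exact: (smemD Xf' (X_mu t _)).
Qed.

(** * Noetherianity *)

Definition stable_at V (Y : nat -> submod V) (i0 : nat) : Prop :=
  forall i, sub_le (Y i) (Y i0).

Lemma stable_at_le V (Y : nat -> submod V) i j :
  (forall i, sub_le (Y i) (Y i.+1)) -> (i <= j)%N ->
  stable_at Y i -> stable_at Y j.
Proof. by move=> Ymono le_ij Yst l s v /Yst; apply: chain_le. Qed.

Lemma iter_mu_preimS V (U W : submod V) j :
  sub_le U W -> sub_le (iter j (@mu_preim V) U) (iter j (@mu_preim V) W).
Proof. by move=> UW; elim: j => //= j IH; apply: mu_preimS. Qed.

(** The step that turns stability of S(Y_i) + xV into stability of Y_i: writing
    u in Y_i as y + x v with y in Y_i1 makes u and x v congruent modulo Y_i1,
    and x v lies in the chain because u and y do. *)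
Lemma mu_join_decomposition V (Y : nat -> submod V) i1 :
  (forall i, sub_le (Y i) (Y i.+1)) -> stable_at (fun i => mu_join (Y i)) i1 ->
  forall i m (u : V m.+1), Y i m.+1 u -> exists v : V m,
    mu_preim (Y (maxn i i1)) m v /\ (Y i1 m.+1 (mu V m v) -> Y i1 m.+1 u).
Proof.
move=> Ymono Jst i m u Yu.
have [|y [v [Yy uE]]] := Jst i m u.
  by exists u, 0; rewrite linear0 addr0.
exists v; split=> [|Yv]; last by rewrite uE; apply: smemD.
have -> : mu_preim (Y (maxn i i1)) m v = Y (maxn i i1) m.+1 (u - y).
  by rewrite uE addrAC subrr add0r.
apply: subspaceB; first exact: submod_subspace.
  exact: chain_le (leq_maxl _ _) _ _ Yu.
exact: chain_le (leq_maxr _ _) _ _ Yy.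
Qed.

(** Stability of S(Y_i) + xV alone does not control Y_i, since the v produced by
    mu_join_decomposition lies in x^-1 Y_i only.  Along the diagonal x^-i Y_i
    the element v stays in the chain, one index further. *)
Lemma noetherian_above_generated s V (U : submod V) :
  (forall n, fg_space (V n)) -> generated_lt U s -> noetherian_above U.
Proof.
elim: s => [|s IH] in V U * => V_fg gen Y UY Ymono.
  by exists 0%N => i t v _; apply: (gen (Y 0%N)).
have join_stable (Z : nat -> submod V) : (forall i, sub_le U (Z i)) ->
    (forall i, sub_le (Z i) (Z i.+1)) ->
    exists i0, stable_at (fun i => mu_join (Z i)) i0.
  move=> UZ Zmono; apply: (IH (S V) (mu_join U)) => [n||i|i].
  - exact: V_fg.
  - exact: generated_lt_mu_join.
  - exact: mu_joinS.
  - exact: mu_joinS.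
have zero_stable (Z : nat -> submod V) : (forall i, sub_le (Z i) (Z i.+1)) ->
    exists i0, forall i (v : V 0%N), Z i 0%N v -> Z i0 0%N v.
  move=> Zmono; apply: subspace_acc => // [i|i v]; first exact: submod_subspace.
  exact: Zmono.
pose pre j i := iter j (@mu_preim V) (Y i).
have pre_mono j i : sub_le (pre j i) (pre j i.+1) by apply: iter_mu_preimS.
have U_pre j i : sub_le U (pre j i).
  by elim: j => [|j IHj] t v Uv; [apply: UY | apply/le_mu_preim/IHj].
have pre_le j j' i : (j <= j')%N -> sub_le (pre j i) (pre j' i).
  by apply: (@chain_le V (pre^~ i)) => l; apply: le_mu_preim.
have [i0 diag_stable] : exists i0, stable_at (fun i => pre i i) i0.
  have diag_mono i : sub_le (pre i i) (pre i.+1 i.+1).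
    by move=> t v /pre_mono/le_mu_preim.
  have [i1 Jst] := join_stable (fun i => pre i i) (fun i => U_pre i i) diag_mono.
  have [i2 Zst] := zero_stable (fun i => pre i i) diag_mono.
  have {}Jst : stable_at (fun i => mu_join (pre i i)) (maxn i1 i2).
    apply: stable_at_le (leq_maxl _ _) Jst => i; exact: mu_joinS.
  exists (maxn i1 i2) => i t; elim: t i => [|t IHt] i u iu.
    exact: (@chain_le V (fun i => pre i i) _ _ diag_mono (leq_maxr _ _)) _ _
      (Zst _ _ iu).
  have [v [vW uP]] := mu_join_decomposition diag_mono Jst iu; apply: uP.
  rewrite muE; apply: smem_act; apply: (IHt (maxn i (maxn i1 i2)).+1).
  exact: (@pre_mono _.+1).
(* Descent from x^-i0 to x^0; the index counts the steps already made. *)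
suff pre_stable j : (j <= i0)%N -> exists i1, stable_at (pre (i0 - j)%N) i1.
  by have [|i1] := pre_stable i0; rewrite ?subnn //; exists i1.
elim: j => [_|j IHj lt_ji0].
  exists i0 => i; rewrite subn0 => t v iv.
  apply: (diag_stable (maxn i i0)); apply: (pre_le i0); first exact: leq_maxr.
  exact: chain_le (leq_maxl _ _) _ _ iv.
have [i1 preS_stable] := IHj (ltnW lt_ji0).
have {preS_stable} := preS_stable; rewrite -[X in pre X]subnSK //.
set l := (i0 - j.+1)%N => preS_stable.
have [i2 Jst] := join_stable (pre l) (U_pre l) (pre_mono l).
have [i3 Zst] := zero_stable (pre l) (pre_mono l).
pose i4 := maxn i1 (maxn i2 i3).
have {}preS_stable : stable_at (pre l.+1) i4.
  by apply: stable_at_le (leq_maxl _ _) preS_stable; apply: pre_mono.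
have {}Jst : stable_at (fun i => mu_join (pre l i)) i4.
  apply: stable_at_le Jst => [i|]; first exact/mu_joinS/pre_mono.
  by rewrite /i4 leq_max leq_maxl orbT.
exists i4 => i [|m] u iu.
  by apply: (chain_le (pre_mono l)) (Zst _ _ iu); rewrite /i4 !leq_max leqnn !orbT.
have [v [vW uP]] := mu_join_decomposition (pre_mono l) Jst iu; apply: uP.
exact: (preS_stable (maxn i i4) m v).
Qed.

(** * Hilbert functions *)

Lemma hilbert_function_step V (U : submod V) HW HD :
  fg_space (V 0%N) -> (forall n, reldim (mu_preim U n) (HW n)) ->
  (forall n, reldim (mu_join U n) (HD n)) ->
  exists H, (forall n, reldim (U n) (H n)) /\ forall n, H n.+1 = (HW n + HD n)%N.
Proof.
move=> V0_fg HWP HDP; have [d dP] := reldim_exists V0_fg (submod_subspace U 0%N).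
exists (fun n => if n is m.+1 then (HW m + HD m)%N else d); split=> // -[//|n].
exact: (reldim_extension (f := mu V n) (submod_subspace U n.+1)).
Qed.

(** When x^-1 U = U, the codimension formula of hilbert_function_step becomes a
    recursion for the codimension of U itself. *)
Lemma hilbert_function_saturated V (U : submod V) HD :
  sub_le (mu_preim U) U -> fg_space (V 0%N) ->
  (forall n, reldim (mu_join U n) (HD n)) ->
  exists H, (forall n, reldim (U n) (H n)) /\ forall n, H n.+1 = (H n + HD n)%N.
Proof.
move=> Usat V0_fg HDP; have [d dP] := reldim_exists V0_fg (submod_subspace U 0%N).
pose fix H n := if n is m.+1 then (H m + HD m)%N else d.
exists H; split=> //; elim=> [//|n IHn].
apply: (reldim_extension (f := mu V n) (submod_subspace U n.+1)) (HDP n).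
by apply: reldim_iff IHn => v; split; [apply: le_mu_preim | apply: Usat].
Qed.

Lemma hilbert_function_generated s V (U : submod V) :
  (forall n, fg_space (V n)) -> generated_lt U s ->
  exists H, (forall n, reldim (U n) (H n)) /\ eventually_poly H s.
Proof.
elim: s => [|s IH] in V U * => V_fg gen.
  exists (fun _ => 0%N); split=> [n|]; first by apply/reldim_full/(gen U).
  by exists 0; rewrite size_poly0; split=> //; exists 0%N => n _; rewrite horner0.
pose Y j := iter j (@mu_preim V) U.
have Ymono j : sub_le (Y j) (Y j.+1) by apply: le_mu_preim.
have UY j : sub_le U (Y j) by apply: (@chain_le V Y 0 j).
have [j0 Yst] := noetherian_above_generated V_fg gen UY Ymono.
have HDP j : exists HD, (forall n, reldim (mu_join (Y j) n) (HD n)) /\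
    eventually_poly HD s.
  apply: IH => [n|]; first exact: V_fg.
  exact/generated_lt_mu_join/generated_ltS/gen.
suff Yhilb j : (j <= j0)%N -> exists H, (forall n, reldim (Y (j0 - j)%N n) (H n)) /\
    eventually_poly H s.+1 by have := Yhilb j0 (leqnn _); rewrite subnn.
elim: j => [_|j IHj lt_jj0].
  have [HD [HDdim HDpoly]] := HDP j0; rewrite subn0.
  have [|H [Hdim HE]] := hilbert_function_saturated _ (V_fg 0%N) HDdim.
    exact: (Yst j0.+1).
  by exists H; split=> //; apply: eventually_poly_difference HDpoly HE.
have [HW []] := IHj (ltnW lt_jj0); rewrite -subnSK //.
set l := (j0 - j.+1)%N => HWdim HWpoly; have [HD [HDdim HDpoly]] := HDP l.
have [H [Hdim HE]] := hilbert_function_step (V_fg 0%N) HWdim HDdim.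
exists H; split=> //; apply: eventually_poly_pred HE.
exact: eventually_polyD (leqnSn s) HWpoly HDpoly.
Qed.

End GenericShift.

(** * Finitely generated modules *)

Section FinitelyGenerated.
Variable V : cmod C.

Definition zero_submod : submod V.
Proof.
refine (@SubMod _ _ V (fun s v => v = 0) _ _ _ _)
  => [//|s u v -> ->|s a v ->|r s f v ->].
- exact: addr0.
- exact: scaler0.
- exact: act0.
Defined.

Lemma generated_lt_zero m : generated_le V (m%:Z - 1) -> generated_lt zero_submod m.
Proof. by move=> gen X Xm _; apply: gen => r le_r; apply: Xm; lia. Qed.

(** In degree n the module is spanned by the f x_i with f in the
    finite-dimensional spaces C(d_i, n). *)
Lemma finitely_generated_fg_space : locally_finite C -> finitely_generated V ->
  forall n, fg_space (V n).
Proof.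
move=> C_fin [l [d [x gen]]] n.
pose Xmem s (v : V s) := exists f : forall i, chom C (d i) s,
  v = \sum_i act (f i) (x i).
have X0 s : Xmem s 0.
  by exists (fun i => 0); rewrite big1 // => i _; apply: act0l.
have XD s (u v : V s) : Xmem s u -> Xmem s v -> Xmem s (u + v).
  move=> [f ->] [g ->]; exists (fun i => f i + g i); rewrite -big_split /=.
  by apply: eq_bigr => i _; rewrite actDl.
have XZ s a (v : V s) : Xmem s v -> Xmem s (a *: v).
  move=> [f ->]; exists (fun i => a *: f i); rewrite scaler_sumr.
  by apply: eq_bigr => i _; rewrite actZl.
have Xact r s (f : chom C r s) (v : V r) : Xmem r v -> Xmem s (act f v).
  move=> [g ->]; exists (fun i => ccomp f (g i)).
  rewrite (big_morph (act f) (id1 := 0) (op1 := +%R)) ?act0 //; last exact: actD.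
  by apply: eq_bigr => i _; rewrite act_comp.
have Xfull : full (SubMod X0 XD XZ Xact).
  apply: gen => i; pose T j : Type := chom C (d j) (d i).
  exists (dfwith (T := T) (fun j => 0) (idm C (d i))).
  rewrite (bigD1 i) //= dfwith_in act1 big1 ?addr0 // => j ne_ji.
  by rewrite dfwith_out ?act0l // eq_sym.
pose lin i := GRing.isLinear.Build k (chom C (d i) n) (V n) _ _
  (act_linearl (s := n) (x i)).
pose L i : {linear chom C (d i) n -> V n} :=
  HB.pack (fun f : chom C (d i) n => act f (x i)) (lin i).
exact: (fg_space_sum (f := L) (fun i => C_fin (d i) n)) (Xfull n).
Qed.

Lemma finitely_generated_gd : finitely_generated V ->
  exists2 m : nat, gd V = (m%:Z - 1)%:E & generated_le V (m%:Z - 1).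
Proof.
move=> [l [d [x gen]]]; rewrite /gd; case: pselect => [h|[]].
  by case: ex_minnP => m /asboolP Vm _; exists m.
exists (\max_i d i).+1; apply/asboolP => X Xd; apply: gen => i; apply: Xd.
have : (d i <= \max_i d i)%N by apply: leq_bigmax.
lia.
Qed.

End FinitelyGenerated.
End Submodules.

Theorem corollary1p13 (k : fieldType) (C : lincat k)
  (C_fin : locally_finite C) (C_dir : directed C)
  (iota : self_embedding C) (S_generic : generic_shift iota)
  (S_fp : forall s : nat, finitely_presented (shift iota (repr_mod C s)))
  (V : cmod C) (V_fg : finitely_generated V) :
  exists H : nat -> nat, is_hilbert_function V H /\
    exists p : {poly rat},
      (poly_degree p <= gd V)%E /\
      exists N : nat, forall n : nat, (N <= n)%N -> (H n)%:R = p.[n%:R].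
Proof.
have [mu [mu_nat mu_inj_gen]] := S_generic.
have [m -> Vm] := finitely_generated_gd V_fg.
have [H [Hdim [p [size_p pH]]]] := hilbert_function_generated mu_nat
  (fun s => (mu_inj_gen s).2) (finitely_generated_fg_space C_fin V_fg)
  (generated_lt_zero Vm).
exists H; split=> [n|]; first exact: has_dim_reldim0.
exists p; split=> //; rewrite /poly_degree; case: eqVneq => [_|p_neq0].
  exact: leNye.
rewrite lee_fin; move: size_p p_neq0; rewrite -size_poly_eq0.
by case: (size p) => // z; lia.
Qed.
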